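(* There is a one-to-one correspondence between Manin triples of $3$-pre-Lie algebras and perfect phase spaces of $3$-Lie algebras. More precisely, let $\omega$ denote the form $\omega(x+\alpha,y+\beta)=\langle\alpha,y\rangle-\langle\beta,x\rangle$ on $V\oplus V^*$ for a vector space $V$. (a) If $(A\oplus A^*;A,A^* )$ is a Manin triple of $3$-pre-Lie algebras (with respect to $\omega$) with $3$-pre-Lie structure $\{\cdot,\cdot,\cdot\}$ on $A\oplus A^*$, then $(A\oplus A^*,[\cdot,\cdot,\cdot]_C,\omega)$ is a symplectic $3$-Lie algebra, where $[u,v,w]_C=\{u,v,w\}+\{v,w,u\}+\{w,u,v\}$. (b) Conversely, if $(\mathfrak h\oplus\mathfrak h^*,[\cdot,\cdot,\cdot],\omega)$ is a perfect phase space of a $3$-Lie algebra $(\mathfrak h,[\cdot,\cdot,\cdot]_{\mathfrak h})$, then $(\mathfrak h\oplus\mathfrak h^*;\mathfrak h,\mathfrak h^* )$ is a Manin triple of $3$-pre-Lie algebras (with respect to $\omega$), where the $3$-pre-Lie algebra structure $\{\cdot,\cdot,\cdot\}$ on $\mathfrak h\oplus\mathfrak h^*$ is given by $\omega(\{u,v,w\},t)=-\omega(w,[u,v,t])$ for all $u,v,w,t\in\mathfrak h\oplus\mathfrak h^*$.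
   Context: All vector spaces are finite-dimensional over $\mathbb K\in\{\mathbb R,\mathbb C\}$. A $3$-Lie algebra is a vector space with a trilinear skew-symmetric bracket satisfying $[x,y,[z,w,v]]=[[x,y,z],w,v]+[z,[x,y,w],v]+[z,w,[x,y,v]]$. A $3$-pre-Lie algebra is a vector space $A$ with a trilinear map $\{\cdot,\cdot,\cdot\}$ such that, with $[x,y,z]_C:=\{x,y,z\}+\{y,z,x\}+\{z,x,y\}$: (1) $\{x,y,z\}=-\{y,x,z\}$; (2) $\{x_1,x_2,\{x_3,x_4,x_5\}\}=\{[x_1,x_2,x_3]_C,x_4,x_5\}+\{x_3,[x_1,x_2,x_4]_C,x_5\}+\{x_3,x_4,\{x_1,x_2,x_5\}\}$; (3) $\{[x_1,x_2,x_3]_C,x_4,x_5\}=\{x_1,x_2,\{x_3,x_4,x_5\}\}+\{x_2,x_3,\{x_1,x_4,x_5\}\}+\{x_3,x_1,\{x_2,x_4,x_5\}\}$. Then $[\cdot,\cdot,\cdot]_C$ is a $3$-Lie bracket. A symplectic structure on a $3$-Lie algebra is a nondegenerate skew-symmetric bilinear form $\omega$ with $\omega([x,y,z],w)-\omega([y,z,w],x)+\omega([z,w,x],y)-\omega([w,x,y],z)=0$; a $3$-Lie algebra with such a form is called a symplectic $3$-Lie algebra. On a symplectic $3$-Lie algebra, the formula $\omega(\{x,y,z\},w)=-\omega(z,[x,y,w])$ defines a $3$-pre-Lie structure with $[\cdot,\cdot,\cdot]_C=[\cdot,\cdot,\cdot]$ (known fact). A phase space of a $3$-Lie algebra $(\mathfrak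 h,[\cdot,\cdot,\cdot]_{\mathfrak h})$ is a $3$-Lie algebra structure on $\mathfrak h\oplus\mathfrak h^*$ for which $\omega(x+\alpha,y+\beta)=\langle\alpha,y\rangle-\langle\beta,x\rangle$ is a symplectic structure and $(\mathfrak h,[\cdot,\cdot,\cdot]_{\mathfrak h})$ and $\mathfrak h^*$ are $3$-Lie subalgebras. It is perfect if $[x,y,\alpha]\in\mathfrak h^*$ and $[\alpha,\beta,x]\in\mathfrak h$ for all $x,y\in\mathfrak h$, $\alpha,\beta\in\mathfrak h^*$. A quadratic $3$-pre-Lie algebra is a $3$-pre-Lie algebra with a nondegenerate skew-symmetric bilinear form $\omega$ such that $\omega(\{x,y,z\},w)=-\omega(z,[x,y,w]_C)$ for all $x,y,z,w$. A Manin triple of $3$-pre-Lie algebras is a triple $(\mathcal A;A,A')$ where $(\mathcal A,\{\cdot,\cdot,\cdot\},\omega)$ is a quadratic $3$-pre-Lie algebra, $A$ and $A'$ are isotropic $3$-pre-Lie subalgebras, $\mathcal A=A\oplus A'$ as vector spaces, and for all $x,y\in A$, $\alpha,\beta\in A'$: $\{x,y,\alpha\}\in A'$, $\{\alpha,x,y\}\in A'$, $\{\alpha,\beta,x\}\in A$, $\{x,\alpha,\beta\}\in A$. By nondegeneracy, $A'$ is identified with $A^*$ via $\langle\alpha,x\rangle=\omega(\alpha,x)$; thus every Manin triple is identified with one of the form $(A\oplus A^*;A,A^* )$ with $\omega(x+\alpha,y+\beta)=\langle\alpha,y\rangle-\langle\beta,x\rangle$. *)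

(* Defs.v *)
From HB Require Import structures.
From mathcomp Require Import all_boot all_order all_algebra.
From mathcomp Require Import boolp classical_sets functions reals.
From mathcomp Require Import complex.

Set Implicit Arguments.
Unset Strict Implicit.
Unset Printing Implicit Defensive.

Import GRing.Theory.
Local Open Scope ring_scope.

Variant scalars := RealScalars | ComplexScalars.

Definition scalar_field (R : realType) (k : scalars) : fieldType :=
  match k with RealScalars => R | ComplexScalars => R[i] end.

Section ThreeLie.
Context {K : fieldType} {V : vectType K}.
Implicit Types (f br P : V -> V -> V -> V) (om : V -> V -> K).

Definition trilinear f : Prop :=
  [/\ forall y z, linear (fun x => f x y z),
      forall x z, linear (fun y => f x y z)
    & forall x y, linear (fun z => f x y z)].

(* The two adjacent transpositions generate S_3. *)
Definition skew_symmetric3 f : Prop :=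
  (forall x y z, f x y z = - f y x z) /\ (forall x y z, f x y z = - f x z y).

Definition three_Lie br : Prop :=
  [/\ trilinear br, skew_symmetric3 br
    & forall x y z w v,
        br x y (br z w v) =
          br (br x y z) w v + br z (br x y w) v + br z w (br x y v)].

Definition commutator3 P : V -> V -> V -> V :=
  fun x y z => P x y z + P y z x + P z x y.

Definition three_pre_Lie P : Prop :=
  let C := commutator3 P in
  [/\ trilinear P,
      forall x y z, P x y z = - P y x z,
      forall x1 x2 x3 x4 x5,
        P x1 x2 (P x3 x4 x5) =
          P (C x1 x2 x3) x4 x5 + P x3 (C x1 x2 x4) x5 + P x3 x4 (P x1 x2 x5)
    & forall x1 x2 x3 x4 x5,
        P (C x1 x2 x3) x4 x5 =
          P x1 x2 (P x3 x4 x5) + P x2 x3 (P x1 x4 x5) + P x3 x1 (P x2 x4 x5)].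

Definition skew_form om : Prop :=
  [/\ bilinear_for *%R *%R om,
      forall x y, om x y = - om y x
    & forall x, (forall y, om x y = 0) -> x = 0].

Definition symplectic_form br om : Prop :=
  skew_form om /\
  forall x y z w,
    om (br x y z) w - om (br y z w) x + om (br z w x) y - om (br w x y) z = 0.

Definition symplectic_three_Lie br om : Prop :=
  three_Lie br /\ symplectic_form br om.

Definition om_adjoint om P br : Prop :=
  forall x y z w, om (P x y z) w = - om z (br x y w).

Definition quadratic_three_pre_Lie P om : Prop :=
  [/\ three_pre_Lie P, skew_form om & om_adjoint om P (commutator3 P)].

Definition closed3 f (U : {vspace V}) : Prop :=
  forall x y z, x \in U -> y \in U -> z \in U -> f x y z \in U.

Definition isotropic om (U : {vspace V}) : Prop :=
  forall x y, x \in U -> y \in U -> om x y = 0.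

Definition manin_triple P om (A A' : {vspace V}) : Prop :=
  [/\ quadratic_three_pre_Lie P om,
      (closed3 P A /\ isotropic om A) /\ (closed3 P A' /\ isotropic om A'),
      (A + A')%VS = fullv /\ (A :&: A')%VS = 0%VS
    & forall x y a b, x \in A -> y \in A -> a \in A' -> b \in A' ->
        [/\ P x y a \in A', P a x y \in A', P a b x \in A & P x a b \in A]].

End ThreeLie.

Section Double.
Context {K : fieldType}.
Variable V : vectType K.

Definition vdual : vectType K := 'Hom(V, K^o).
Definition vdouble : vectType K := (V * vdual)%type.

Definition std_form (u v : vdouble) : K := u.2 v.1 - v.2 u.1.

Definition in_base (x : V) : vdouble := (x, 0).
Definition in_dual (a : vdual) : vdouble := (0, a).

Fact in_base_linear : linear in_base.
Proof. by move=> c x y; congr (_, _); rewrite /= scaler0 addr0. Qed.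
HB.instance Definition _ :=
  GRing.isLinear.Build K V vdouble *:%R in_base in_base_linear.

Fact in_dual_linear : linear in_dual.
Proof. by move=> c x y; congr (_, _); rewrite /= scaler0 addr0. Qed.
HB.instance Definition _ :=
  GRing.isLinear.Build K vdual vdouble *:%R in_dual in_dual_linear.

Definition base_space : {vspace vdouble} := limg (linfun in_base).
Definition dual_space : {vspace vdouble} := limg (linfun in_dual).

Definition phase_space (brV : V -> V -> V -> V)
    (br : vdouble -> vdouble -> vdouble -> vdouble) : Prop :=
  [/\ three_Lie brV, symplectic_three_Lie br std_form,
      forall x y z,
        br (in_base x) (in_base y) (in_base z) = in_base (brV x y z)
    & closed3 br dual_space].

Definition perfect_phase_space (brV : V -> V -> V -> V)
    (br : vdouble -> vdouble -> vdouble -> vdouble) : Prop :=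
  phase_space brV br /\
  forall x y a b, x \in base_space -> y \in base_space ->
    a \in dual_space -> b \in dual_space ->
    br x y a \in dual_space /\ br a b x \in base_space.

Definition std_manin_triple (P : vdouble -> vdouble -> vdouble -> vdouble) : Prop :=
  manin_triple P std_form base_space dual_space.

(* The second component is the bracket on V + V^*; the first one is its
   restriction to V, which takes values in V when V is a subalgebra. *)
Definition phase_of_manin (P : vdouble -> vdouble -> vdouble -> vdouble) :
    (V -> V -> V -> V) * (vdouble -> vdouble -> vdouble -> vdouble) :=
  (fun x y z => (commutator3 P (in_base x) (in_base y) (in_base z)).1,
   commutator3 P).

End Double.

(* Main.v *)
From HB Require Import structures.
Require Import Defs.
From mathcomp Require Import all_boot all_order all_algebra.
From mathcomp Require Import boolp classical_sets functions reals.
From mathcomp Require Import ring.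
Local Open Scope ring_scope.
Local Open Scope classical_set_scope.

Import GRing.Theory.

(** The defining relation of a quadratic 3-pre-Lie algebra,
    [om {x,y,z} w = - om z [x,y,w]], says that left multiplication [{x,y,-}] is
    minus the [om]-adjoint of [[x,y,-]].  Since [om] is nondegenerate, the product
    and the bracket determine each other, and the correspondence between Manin
    triples and perfect phase spaces is this duality, from product to commutator
    and back.

    Every property is carried across by pairing with [om].

    - Algebraic identities.  The commutator of any 3-pre-Lie product is a 3-Lie
      bracket ([commutator3_three_Lie]), and the symplectic cocycle identity for it
      is the sum of three adjunction relations ([quadratic_symplectic]).
      Conversely, for a symplectic 3-Lie bracket the same cocycle identity says
      that the adjoint product has that bracket as its commutator
      ([adjoint_commutator]); the first 3-pre-Lie axiom is then the adjoint of the
      fundamental identity, and the second is the adjoint of a consequence of it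
      ([fundamental_star]): see [adjoint_quadratic].

    - Subspaces.  For the standard form on V + V^*, both summands are equal to
      their own orthogonals ([base_space_orthogonal], [dual_space_orthogonal]).
      Hence [{u,v,w}] lies in a summand S if and only if [om w [u,v,t]] vanishes
      for all t in S, so each closure condition on the product follows from one on
      the bracket ([perfect_std_manin]).  In the other direction the conditions are
      read off from the three terms of the commutator ([std_manin_perfect]).

    - Existence of the product.  V + V^* is finite-dimensional, so every linear
      form on it is [om p] for some p ([std_form_represents]). *)

(** * Linear maps given as plain functions *)

Section LinearFunctions.
Context {K : fieldType} {U : lmodType K} {W : zmodType}.

Lemma linear_for_add (s : K -> W -> W) (f : U -> W) :
  (forall w, s 1 w = w) -> GRing.linear_for s f -> {morph f : u v / u + v}.
Proof. by move=> s1 lf u v; have := lf 1 u v; rewrite scale1r s1. Qed.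

Lemma add_morph_opp (f : U -> W) :
  {morph f : u v / u + v} -> {morph f : u / - u}.
Proof.
move=> fD u.
have f0 : f 0 = 0 by apply: (addIr (f 0)); rewrite -fD !add0r.
by apply/eqP; rewrite -addr_eq0 -fD addNr f0.
Qed.

End LinearFunctions.

(** Leaves to [ring] the check that a goal is a linear combination of known
    equations, themselves combined into [c = d]. *)
Lemma eq_by_sub {K : zmodType} (c d a b : K) : c = d -> a - b = c - d -> a = b.
Proof. by move=> ->; rewrite subrr => /eqP; rewrite subr_eq0 => /eqP. Qed.

Section Functionals.
Context {K : fieldType} {V : vectType K}.

(** Coordinates separate vectors; this turns a signed sum of vectors into a scalar
    identity, where [ring] applies. *)
Lemma scalar_ext (u v : V) : (forall f : {scalar V}, f u = f v) -> u = v.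
Proof.
move=> H; rewrite (coord_vbasis (memvf u)) (coord_vbasis (memvf v)).
by apply: eq_bigr => i _; rewrite (H (coord (vbasis fullv) i)).
Qed.

(** Evaluation on a basis shows that a finite-dimensional space is reflexive. *)
Lemma dual_reflexive (phi : vdual V -> K) :
  GRing.linear_for *%R phi -> exists x : V, forall a : vdual V, a x = phi a.
Proof.
move=> lphi; pose n0 := \dim (fullv : {vspace V}).
pose e (i : 'I_n0) := (vbasis (fullv : {vspace V}))`_i.
pose d (i : 'I_n0) : vdual V := linfun (coord (vbasis (fullv : {vspace V})) i : V -> K^o).
exists (\sum_i phi (d i) *: e i) => a.
have phi_sum (n : nat) (c : 'I_n -> K) (b : 'I_n -> vdual V) :
    phi (\sum_i c i *: b i) = \sum_i c i * phi (b i).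
  have phiD := linear_for_add *%R phi (@mul1r K) lphi.
  have phi0 : phi 0 = 0 by apply: (addIr (phi 0)); rewrite -phiD !add0r.
  have phiZ k b0 : phi (k *: b0) = k * phi b0.
    by have := lphi k b0 0; rewrite !addr0 phi0 addr0.
  by rewrite (big_morph phi phiD phi0); apply: eq_bigr => i _; rewrite phiZ.
have -> : phi a = phi (\sum_i (a (e i) : K) *: d i).
  congr (phi _); apply/lfunP => v.
  rewrite {1}(coord_vbasis (memvf v)) linear_sum sum_lfunE.
  apply: eq_bigr => i _; rewrite linearZ /= scale_lfunE lfunE /=.
  by rewrite /GRing.scale /= mulrC.
rewrite phi_sum linear_sum; apply: eq_bigr => i _.
by rewrite linearZ /= mulrC.
Qed.

End Functionals.

(** * From 3-pre-Lie products to 3-Lie brackets and back *)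

Section Brackets.
Context {K : fieldType} {V : vectType K}.
Implicit Types (P br : V -> V -> V -> V) (om : V -> V -> K).

Section TrilinearTheory.
Context {f : V -> V -> V -> V} (lf : trilinear f).

Lemma trilinearD3 x y : {morph (fun z => f x y z) : u v / u + v}.
Proof. by case: lf => _ _ H; apply: linear_for_add (H x y); apply: scale1r. Qed.
Lemma trilinearN3 x y : {morph (fun z => f x y z) : u / - u}.
Proof. by apply: add_morph_opp; apply: trilinearD3. Qed.

End TrilinearTheory.

Section SkewFormTheory.
Context {om : V -> V -> K} (som : skew_form om).

Lemma skew_formP2 x a : {morph om x : u v / a *: u + v >-> a * u + v}.
Proof. by case: som => -[_ H] _ _ u v; apply: H. Qed.
Lemma skew_formP1 y a : {morph om^~ y : u v / a *: u + v >-> a * u + v}.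
Proof. by case: som => -[H _] _ _ u v; apply: H. Qed.
Lemma skew_formD1 y : {morph om^~ y : u v / u + v}.
Proof. by apply: (linear_for_add *%R _ (@mul1r K)) => a; apply: skew_formP1. Qed.
Lemma skew_formD2 x : {morph om x : u v / u + v}.
Proof. by apply: (linear_for_add *%R _ (@mul1r K)) => a; apply: skew_formP2. Qed.
Lemma skew_formN1 y : {morph om^~ y : u / - u}.
Proof. by apply: add_morph_opp; apply: skew_formD1. Qed.
Lemma skew_formN2 x : {morph om x : u / - u}.
Proof. by apply: add_morph_opp; apply: skew_formD2. Qed.
Lemma skew_formC x y : om x y = - om y x.
Proof. by case: som => _ H _; apply: H. Qed.

Lemma skew_form_inj x y : (forall w, om x w = om y w) -> x = y.
Proof.
case: som => _ _ nd H; apply/eqP; rewrite -subr_eq0; apply/eqP/nd => w.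
by rewrite skew_formD1 skew_formN1 H subrr.
Qed.

Lemma om_adjoint_inj br P Q :
  om_adjoint om P br -> om_adjoint om Q br -> P = Q.
Proof.
move=> aP aQ; apply/funext => x; apply/funext => y; apply/funext => z.
by apply: skew_form_inj => w; rewrite aP aQ.
Qed.

End SkewFormTheory.

(** The fundamental identity is split along the three terms of the outer
    commutator: the term acting by [P x y] is expanded by the first axiom, and the
    two terms with an inner commutator in an acting slot by the second. *)
Lemma commutator3_three_Lie P : three_pre_Lie P -> three_Lie (commutator3 P).
Proof.
case=> lP sP P1 P2; split.
- case: lP => L1 L2 L3.
  split=> u v a p q; rewrite /commutator3 (L1, L2, L3) (L1, L2, L3) (L1, L2, L3);
    by apply: scalar_ext => f; rewrite !linearD /= !linearZ /=; ring.
- split=> x y z; rewrite /commutator3; apply: scalar_ext => f.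
  + rewrite (sP y x z) (sP x z y) (sP z y x); rewrite !(linearD, linearN) /=; ring.
  + rewrite (sP x z y) (sP z y x) (sP y x z); rewrite !(linearD, linearN) /=; ring.
move=> x y z w v; pose C := commutator3 P.
have CE a b c : C a b c = P a b c + P b c a + P c a b by [].
have CPd a b c d e : P (C a b c) d e =
    P a b (P c d e) + P b c (P a d e) + P c a (P b d e) by exact: P2.
have PCd a b c d e : P d (C a b c) e =
    - (P a b (P c d e) + P b c (P a d e) + P c a (P b d e)).
  by rewrite sP CPd.
have PPC a b c d e : P a b (C c d e) =
    P a b (P c d e) + P a b (P d e c) + P a b (P e c d).
  by rewrite CE !(trilinearD3 lP).
have PPs a b c d e : P a b (P c d e) = - P a b (P d c e).
  by rewrite (sP c d e) (trilinearN3 lP).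
rewrite -/C (CE x y (C z w v)) (CE z w v) !(trilinearD3 lP) !(P1 x y) -/C.
rewrite (CE (C x y z)) (CE z (C x y w)) (CE z w (C x y v)) (PCd z w v) (CPd z w v).
rewrite !PPC.
rewrite (PPs z w v y) (PPs w v z y) (PPs v z w y).
by apply: scalar_ext => f; rewrite !(linearD, linearN) /=; ring.
Qed.

(** This is the dual form of the fundamental identity that becomes the second
    3-pre-Lie axiom.  Apply the derivation [[x1,x2,-]] to [[x3,x4,w]], and the
    derivation [[x3,w,-]] to [[x1,x2,x4]].  Both results evaluate the same sum
    [[x1,x2,[x3,x4,w]] + [x3,w,[x1,x2,x4]]], and the difference of the two values
    is the identity. *)
Lemma fundamental_star br : three_Lie br -> forall x1 x2 x3 x4 w,
  br (br x1 x2 x3) x4 w + br x3 x4 (br x1 x2 w) + br x1 x4 (br x2 x3 w)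
    + br x2 x4 (br x3 x1 w) = 0.
Proof.
case=> lbr [s12 s23] FI x1 x2 x3 x4 w.
have I1 := FI x1 x2 x3 x4 w; have I2 := FI x3 w x1 x2 x4.
have cyc a b c : br a b c = br b c a by rewrite s12 s23 opprK.
have e1 : br x3 (br x1 x2 x4) w = - br x3 w (br x1 x2 x4) by rewrite s23.
have e2 : br x1 x2 (br x3 w x4) = - br x1 x2 (br x3 x4 w).
  by rewrite (s23 x3) (trilinearN3 lbr).
have e3 : br (br x3 w x1) x2 x4 = - br x2 x4 (br x3 x1 w).
  by rewrite cyc (s23 x3) (trilinearN3 lbr).
have e4 : br x1 (br x3 w x2) x4 = - br x1 x4 (br x2 x3 w).
  by rewrite s23 -(cyc x2).
rewrite e1 in I1; rewrite e2 e3 e4 in I2.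
apply: scalar_ext => f; move: I1 I2 => /(congr1 f) + /(congr1 f).
rewrite !(linearD, linearN, linear0) /= => I1 I2.
apply: eq_by_sub (esym (congr2 (fun a b => a - b) I1 I2)) _; ring.
Qed.

(** The three terms of the commutator are moved across [om] one at a time; what
    appears is the cocycle identity, up to a cyclic shift of the bracket. *)
Lemma quadratic_symplectic P om : quadratic_three_pre_Lie P om ->
  symplectic_three_Lie (commutator3 P) om.
Proof.
case=> preP som adj; have LieC := commutator3_three_Lie P preP.
split=> //; split=> // x y z w.
have [_ [s12 s23] _] := LieC.
have e : om (commutator3 P x y z) w =
    - om z (commutator3 P x y w) - om x (commutator3 P y z w)
    - om y (commutator3 P z x w).
  by rewrite {1}/commutator3 !(skew_formD1 som) !adj.
rewrite e (skew_formC som z) (skew_formC som x) (skew_formC som y) (s23 z x w).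
rewrite (s12 w x y) (s23 x w y).
by rewrite !(skew_formN1 som) !opprK; ring.
Qed.

Section Adjoint.
Context {br P : V -> V -> V -> V} {om : V -> V -> K}.
Hypotheses (symp : symplectic_three_Lie br om) (adj : om_adjoint om P br).

Let som : skew_form om. Proof. by case: symp => _ []. Qed.

Lemma adjoint_commutator : commutator3 P = br.
Proof.
case: symp => -[_ [s12 s23] _] [_ cocycle].
apply/funext => x; apply/funext => y; apply/funext => z.
apply: (skew_form_inj som) => w.
rewrite /commutator3 !(skew_formD1 som) !adj.
move: (cocycle x y z w).
rewrite (skew_formC som z) (skew_formC som x) (skew_formC som y) (s23 z x w).
rewrite (s12 w x y) (s23 x w y).
rewrite !(skew_formN1 som) !opprK => c; apply: eq_by_sub (esym c) _; ring.
Qed.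

(** Both 3-pre-Lie axioms, paired with [w], are values of [om x5] on identities
    of the 3-Lie bracket. *)
Lemma adjoint_quadratic : quadratic_three_pre_Lie P om.
Proof.
have Cbr := adjoint_commutator.
case: symp => LieB _; have [lbr [s12 s23] FI] := LieB; have [L1 L2 L3] := lbr.
split=> //; last by rewrite Cbr.
split; rewrite ?Cbr.
- split=> u v a p q; apply: (skew_form_inj som) => w;
    rewrite ?(skew_formP1 som) !adj ?L1 ?L2 (skew_formP2 som, skew_formP1 som);
    ring.
- move=> x y z; apply: (skew_form_inj som) => w.
  by rewrite (skew_formN1 som) !adj s12 (skew_formN2 som).
- move=> x1 x2 x3 x4 x5; apply: (skew_form_inj som) => w.
  rewrite !(skew_formD1 som) !adj (FI x1 x2) !(skew_formD2 som); ring.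
- move=> x1 x2 x3 x4 x5; apply: (skew_form_inj som) => w.
  rewrite !(skew_formD1 som) !adj.
  have := congr1 (om x5) (fundamental_star br LieB x1 x2 x3 x4 w).
  have om0 : om x5 0 = 0.
    by apply: (addIr (om x5 0)); rewrite -(skew_formD2 som) !add0r.
  by rewrite om0 !(skew_formD2 som) => c; apply: eq_by_sub (esym c) _; ring.
Qed.

(** A subspace that contains its orthogonal detects membership by pairing. *)
Lemma adjoint_mem (S : {vspace V}) u v w :
  (forall t, (forall s, s \in S -> om t s = 0) -> t \in S) ->
  (forall t, t \in S -> om w (br u v t) = 0) -> P u v w \in S.
Proof. by move=> orthS H; apply: orthS => t St; rewrite adj H ?oppr0. Qed.

End Adjoint.

End Brackets.

(** * The standard form on V + V^* *)

Section Double.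
Context {K : fieldType} {V : vectType K}.
Implicit Types (u v w t : vdouble V) (brV : V -> V -> V -> V).
Implicit Types (P br : vdouble V -> vdouble V -> vdouble V -> vdouble V).

Local Notation om := (@std_form K V).

Lemma in_baseE u : (u \in base_space V) = (u.2 == 0).
Proof.
apply/memv_imgP/eqP => [[x _ ->]|u0]; first by rewrite lfunE.
by exists u.1; rewrite ?memvf // lfunE /= /in_base -u0; case: u {u0}.
Qed.

Lemma in_dualE u : (u \in dual_space V) = (u.1 == 0).
Proof.
apply/memv_imgP/eqP => [[x _ ->]|u0]; first by rewrite lfunE.
by exists u.2; rewrite ?memvf // lfunE /= /in_dual -u0; case: u {u0}.
Qed.

Lemma std_form_skew : skew_form om.
Proof.
split.
- have pull (a b c d e : K) : a * b + c - (a * d + e) = a * (b - d) + (c - e) by ring.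
  split=> [v|u] a x y; rewrite /std_form /= add_lfunE scale_lfunE linearP;
    exact: pull.
- by move=> x y; rewrite /std_form opprB.
- move=> x H.
  have x2 : x.2 = 0.
    apply/lfunP => v; have := H (in_base v).
    by rewrite /std_form /= !zero_lfunE subr0.
  have x1 : x.1 = 0.
    apply: scalar_ext => f; rewrite linear0.
    have := H (in_dual (linfun (f : V -> K^o))).
    by rewrite /std_form /= linear0 lfunE /= sub0r => /eqP; rewrite oppr_eq0 => /eqP.
  by case: x x1 x2 {H} => x a /= -> ->.
Qed.

Lemma base_space_isotropic : isotropic om (base_space V).
Proof.
by move=> x y; rewrite !in_baseE /std_form => /eqP-> /eqP->; rewrite !zero_lfunE subr0.
Qed.

Lemma dual_space_isotropic : isotropic om (dual_space V).
Proof.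
by move=> x y; rewrite !in_dualE /std_form => /eqP-> /eqP->; rewrite !linear0 ?addr0.
Qed.

Lemma base_space_orthogonal t :
  (forall s, s \in base_space V -> om t s = 0) -> t \in base_space V.
Proof.
move=> H; rewrite in_baseE; apply/eqP/lfunP => v.
have := H (in_base v); rewrite in_baseE eqxx => /(_ isT).
by rewrite /std_form /= !zero_lfunE subr0.
Qed.

Lemma dual_space_orthogonal t :
  (forall s, s \in dual_space V -> om t s = 0) -> t \in dual_space V.
Proof.
move=> H; rewrite in_dualE; apply/eqP/scalar_ext => f; rewrite linear0.
have := H (in_dual (linfun (f : V -> K^o))); rewrite in_dualE eqxx => /(_ isT).
by rewrite /std_form /= linear0 lfunE /= sub0r => /eqP; rewrite oppr_eq0 => /eqP.
Qed.

Lemma base_dual_direct :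
  (base_space V + dual_space V)%VS = fullv /\
  (base_space V :&: dual_space V)%VS = 0%VS.
Proof.
split.
- apply/eqP; rewrite eqEsubv subvf /=; apply/subvP => u _.
  have -> : u = in_base u.1 + in_dual u.2.
    by case: u => x a; congr (_, _); rewrite /= ?addr0 ?add0r.
  by apply: memv_add; rewrite ?in_baseE ?in_dualE.
- apply/eqP; rewrite -subv0; apply/subvP => u.
  rewrite memv_cap in_baseE in_dualE memv0 => /andP[/eqP u2 /eqP u1].
  by case: u u1 u2 => x a /= -> ->.
Qed.

Lemma std_form_represents (phi : vdouble V -> K) :
  GRing.linear_for *%R phi -> exists p, forall t, om p t = phi t.
Proof.
move=> lphi.
have phiD := linear_for_add *%R phi (@mul1r K) lphi.
have lbase : linear (fun x : V => phi (in_base x) : K^o).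
  by move=> c x y; rewrite linearP lphi.
have ldual : GRing.linear_for *%R (fun a : vdual V => - phi (in_dual a)).
  by move=> c a b; rewrite linearP lphi opprD mulrN.
have [x xE] := dual_reflexive _ ldual.
pose f := HB.pack_for {linear V -> K^o} (fun x : V => phi (in_base x) : K^o)
  (GRing.isLinear.Build K V K^o *:%R _ lbase).
have [g gE] : exists g : vdual V, forall y, g y = phi (in_base y).
  by exists (linfun f) => y; exact: (lfunE f y).
exists (x, g) => t; rewrite /std_form /= xE gE opprK -phiD.
by congr phi; case: t => y a; congr (_, _); rewrite /= ?addr0 ?add0r.
Qed.

Lemma om_adjoint_exists br : trilinear br -> exists P, om_adjoint om P br.
Proof.
case=> _ _ L3.
have H (q : vdouble V * vdouble V * vdouble V) :
    exists p, forall t, om p t = - om q.2 (br q.1.1 q.1.2 t).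
  apply: std_form_represents => c s t.
  by rewrite L3 (skew_formP2 std_form_skew) opprD mulrN.
have [P PE] := choice H.
by exists (fun x y z => P (x, y, z)) => x y z w; rewrite PE.
Qed.

(** * The correspondence *)

Lemma in_base_inj : injective (@in_base K V).
Proof. by move=> x y []. Qed.

Lemma in_base_mem (x : V) : in_base x \in base_space V.
Proof. by rewrite in_baseE. Qed.

(** The restriction of a 3-Lie bracket to a subalgebra is a 3-Lie bracket; here
    the subalgebra is V, seen through the injection [in_base]. *)
Lemma in_base_three_Lie brV br : three_Lie br ->
  (forall x y z, br (in_base x) (in_base y) (in_base z) = in_base (brV x y z)) ->
  three_Lie brV.
Proof.
case=> -[L1 L2 L3] [s12 s23] FI E; split.
- split=> u v a p q; apply: in_base_inj; rewrite linearP /= -!E linearP /=.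
  + exact: L1.
  + exact: L2.
  + exact: L3.
- by split=> x y z; apply: in_base_inj; rewrite linearN /= -!E; [apply: s12|apply: s23].
- by move=> x y z w v; apply: in_base_inj; rewrite !linearD /= -!E FI.
Qed.

Lemma std_manin_perfect P : std_manin_triple P ->
  perfect_phase_space (phase_of_manin P).1 (phase_of_manin P).2.
Proof.
case=> quadP [[clA _] [clA' _]] _ mix.
have symp := quadratic_symplectic P om quadP.
have [LieC _] := symp; have [[_ sP _ _] _ _] := quadP.
have E x y z : commutator3 P (in_base x) (in_base y) (in_base z) =
    in_base (commutator3 P (in_base x) (in_base y) (in_base z)).1.
  set u := commutator3 _ _ _ _.
  have: u \in base_space V by rewrite !rpredD // clA // in_base_mem.
  by rewrite in_baseE /in_base => /eqP <-; case: (u).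
split=> /=.
  split=> //; first exact: in_base_three_Lie LieC E.
  by move=> x y z Ax Ay Az; rewrite !rpredD // clA'.
move=> x y a b Ax Ay Aa Ab.
have [m1 m2 m3 m4] := mix x y a b Ax Ay Aa Ab.
have [_ n2 _ n4] := mix y x b a Ay Ax Ab Aa.
have [_ _ _ k4] := mix x x b a Ax Ax Ab Aa.
rewrite /commutator3 (sP y a x) (sP b x a).
by split; rewrite !(rpredD, rpredN) //; case: (mix y x a b Ay Ax Aa Ab).
Qed.

Lemma perfect_std_manin brV br P : perfect_phase_space brV br ->
  om_adjoint om P br -> std_manin_triple P.
Proof.
case=> -[_ symp E clA'] perf adj.
have [[_ [s12 s23] _] _] := symp.
have cyc a b c : br a b c = br b c a by rewrite s12 s23 opprK.
have clA : closed3 br (base_space V).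
  move=> u v w /memv_imgP[x _ ->] /memv_imgP[y _ ->] /memv_imgP[z _ ->].
  by rewrite !lfunE /= E in_base_mem.
have isoA := base_space_isotropic; have isoA' := dual_space_isotropic.
split.
- exact: adjoint_quadratic symp adj.
- split; split=> // u v w Su Sv Sw.
  + by apply: (adjoint_mem adj _ _ _ _ base_space_orthogonal) => t St; rewrite isoA ?clA.
  + by apply: (adjoint_mem adj _ _ _ _ dual_space_orthogonal) => t St; rewrite isoA' ?clA'.
- exact: base_dual_direct.
move=> x y a b Ax Ay Aa Ab; split.
- apply: (adjoint_mem adj _ _ _ _ dual_space_orthogonal) => t St.
  by rewrite isoA' //; case: (perf x y t t).
- apply: (adjoint_mem adj _ _ _ _ dual_space_orthogonal) => t St.
  by rewrite isoA // s23 rpredN; case: (perf x x a t).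
- apply: (adjoint_mem adj _ _ _ _ base_space_orthogonal) => t St.
  by rewrite isoA //; case: (perf t t a b).
- apply: (adjoint_mem adj _ _ _ _ base_space_orthogonal) => t St.
  by rewrite isoA' // s23 rpredN; case: (perf x t a a).
Qed.

Lemma phase_of_adjoint brV br P : perfect_phase_space brV br ->
  om_adjoint om P br -> phase_of_manin P = (brV, br).
Proof.
case=> -[_ symp E _] _ adj; rewrite /phase_of_manin (adjoint_commutator symp adj).
congr pair; apply/funext => x; apply/funext => y; apply/funext => z.
by rewrite E.
Qed.

End Double.

Theorem theorem4p11 (R : realType) (k : scalars)
    (V : vectType (scalar_field R k)) :
  [/\ set_bij [set P | std_manin_triple P]
              [set p : (V -> V -> V -> V) *
                       (vdouble V -> vdouble V -> vdouble V -> vdouble V) |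
                perfect_phase_space p.1 p.2]
              (@phase_of_manin _ V),
      (forall P : vdouble V -> vdouble V -> vdouble V -> vdouble V,
        std_manin_triple P ->
        symplectic_three_Lie (commutator3 P) (@std_form _ V))
    & (forall (brV : V -> V -> V -> V)
              (br : vdouble V -> vdouble V -> vdouble V -> vdouble V),
        perfect_phase_space brV br ->
        (exists! P, om_adjoint (@std_form _ V) P br) /\
        (forall P, om_adjoint (@std_form _ V) P br ->
          std_manin_triple P /\ phase_of_manin P = (brV, br)))].
Proof.
have adjoint_ex brV br : perfect_phase_space brV br ->
    exists P, om_adjoint (@std_form _ V) P br.
  by case=> -[_ [[lbr _ _] _] _ _] _; apply: om_adjoint_exists.
split.
- split.
  + by move=> P /=; apply: std_manin_perfect.
  (* Both products are adjoint to the bracket that they share. *)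
  + move=> P Q /set_mem[[_ _ adjP] _ _ _] /set_mem[[_ _ adjQ] _ _ _] [_ eqC].
    by apply: (om_adjoint_inj std_form_skew _ _ _ adjP); rewrite eqC.
  + move=> [brV br] /= perf; have [P adj] := adjoint_ex brV br perf.
    by exists P; [apply: perfect_std_manin perf adj | apply: phase_of_adjoint].
- by move=> P [quadP _ _ _]; apply: quadratic_symplectic.
- move=> brV br perf; split; last first.
    by move=> P adj; split; [apply: perfect_std_manin perf adj | apply: phase_of_adjoint].
  have [P adj] := adjoint_ex brV br perf.
  by exists P; split=> // Q adjQ; apply: om_adjoint_inj std_form_skew _ _ _ adj adjQ.
Qed.
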